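(* Let $N\ge 2$. There exists a constant $C_N>0$ depending only on $N$ such that the following holds. Suppose $\Lambda$ is a weakly admissible lattice in $\mathbb{R}^N$, let $Q_1,\ldots,Q_N>0$, and let $Z_{\boldsymbol{Q}}$ be a translate of the box $[-Q_1,Q_1]\times\cdots\times[-Q_N,Q_N]$. Then $$\left|\#(\Lambda\cap Z_{\boldsymbol{Q}})-\frac{\mathrm{Vol}\, Z_{\boldsymbol{Q}}}{\det\Lambda}\right|\le C_N \inf_{0<B\leq Q_{max}}\left(\frac{\overline{Q}}{\nu(\Lambda,B)}+\frac{Q_{max}}{B}\right)^{N-1}.$$
   Context: A lattice in $\mathbb{R}^N$ always means a lattice of rank $N$. $|\cdot|$ denotes the Euclidean norm. For $\Gamma\subset\mathbb{R}^N$ and $\rho>0$ put $\nu(\Gamma,\rho):=\inf\{|x_1\cdots x_N|^{1/N} : \underline{\mathbf{x}}=(x_1,\ldots,x_N)\in\Gamma\setminus\{\mathbf{0}\},\ |\underline{\mathbf{x}}|<\rho\}$, where $\inf\emptyset=\infty$ and $1/\infty$ is interpreted as $0$. A lattice $\Lambda$ in $\mathbb{R}^N$ is called weakly admissible if $\nu(\Lambda,\rho)>0$ for all $\rho>0$. $Q_{max}:=\max_i Q_i$ and $\overline{Q}:=(Q_1\cdots Q_N)^{1/N}$. *)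

(* Defs.v *)
From HB Require Import structures.
From mathcomp Require Import all_boot all_order all_algebra.
From mathcomp Require Import all_classical all_reals all_analysis.

Set Implicit Arguments.
Unset Strict Implicit.
Unset Printing Implicit Defensive.

Import Order.TTheory GRing.Theory Num.Theory.
Import numFieldNormedType.Exports.

Local Open Scope classical_set_scope.
Local Open Scope ring_scope.

(* The canonical norm on ['rV[R]_N] is the sup norm, hence this definition. *)
Definition enorm (R : realType) (N : nat) (x : 'rV[R]_N) : R :=
  Num.sqrt (\sum_i x 0 i ^+ 2).

(* The rows of [A] are the basis vectors. *)
Definition lattice_basis (R : realType) (N : nat) (A : 'M[R]_N)
    (L : set 'rV[R]_N) : Prop :=
  A \in unitmx /\ L = [set map_mx intr z *m A | z in [set: 'rV[int]_N]].

Definition is_lattice (R : realType) (N : nat) (L : set 'rV[R]_N) : Prop :=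
  exists A : 'M[R]_N, lattice_basis A L.

(* Computed from a chosen basis; [lattice_detE] shows independence of it. *)
Definition lattice_det (R : realType) (N : nat) (L : set 'rV[R]_N) : R :=
  `|\det (xget 0 [set A : 'M[R]_N | lattice_basis A L])|.

Definition geo_mean (R : realType) (N : nat) (q : 'I_N -> R) : R :=
  (\prod_i q i) `^ N%:R^-1.

(* [ereal_inf set0 = +oo] and [(+oo)^-1 = 0] in [\bar R]. *)
Definition nu (R : realType) (N : nat) (L : set 'rV[R]_N) (rho : R) : \bar R :=
  ereal_inf [set (`|\prod_i x 0 i| `^ N%:R^-1)%:E
            | x in [set x | [/\ L x, x != 0 & enorm x < rho]]].

Definition weakly_admissible (R : realType) (N : nat) (L : set 'rV[R]_N) :
    Prop :=
  is_lattice L /\ forall rho : R, 0 < rho -> (0 < nu L rho)%E.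

Definition centered_box (R : realType) (N : nat) (Q : 'I_N -> R) :
    set 'rV[R]_N :=
  [set x | forall i, - Q i <= x 0 i <= Q i].

Definition translate (R : realType) (N : nat) (t : 'rV[R]_N)
    (A : set 'rV[R]_N) : set 'rV[R]_N :=
  [set t + x | x in A].

(* N-dimensional Lebesgue measure: the N-fold product of [lebesgue_measure],
   i.e. [product_measure1] (the integral of the measures of the sections)
   unfolded and iterated over the coordinates. *)
Fixpoint vol (R : realType) (N : nat) : set 'rV[R]_N -> \bar R :=
  match N return set 'rV[R]_N -> \bar R with
  | 0 => fun A => (\1_A (0 : 'rV[R]_0))%:E
  | n.+1 => fun A =>
      (\int[@lebesgue_measure R]_(x in [set: R])
         vol [set y : 'rV[R]_n | A (row_mx (const_mx x : 'rV[R]_1) y)])%E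
  end.

Definition Qmax (R : realType) (N : nat) (Q : 'I_N -> R) : R :=
  \big[Num.max/0]_i Q i.

Lemma lattice_detE (R : realType) (N : nat) (A : 'M[R]_N)
    (L : set 'rV[R]_N) : lattice_basis A L -> lattice_det L = `|\det A|.
Proof.
have sub (B C : 'M[R]_N) : lattice_basis B L -> lattice_basis C L ->
    exists T : 'M[int]_N, B = map_mx intr T *m C.
  move=> [_ LB] [_ LC].
  have rowB i : exists z : 'rV[int]_N, map_mx intr z *m C = row i B.
    have : L (row i B).
      by rewrite LB; exists (delta_mx 0 i) => //; rewrite map_delta_mx -rowE.
    by rewrite LC => -[z _ zE]; exists z.
  have [f fE] := choice rowB.
  exists (\matrix_i f i); apply/row_matrixP => i.
  by rewrite row_mul -map_row rowK fE.
move=> hA; rewrite /lattice_det; case: xgetP => [B _ hB|/(_ A)//].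
have [T TE] := sub _ _ hB hA; have [S SE] := sub _ _ hA hB.
have uA : \det A != 0 by case: hA; rewrite unitmxE unitfE.
have : map_mx intr (S *m T) *m A = 1%:M *m A :> 'M[R]_N.
  by rewrite map_mxM -mulmxA -TE -SE mul1mx.
move/(congr1 determinant); rewrite !det_mulmx det1 => /(mulIf uA).
rewrite det_map_mx det_mulmx -[1]/(1%:~R) => /intr_inj ST1.
have uT : \det T \is a GRing.unit.
  by apply/unitrP; exists (\det S); split=> //; rewrite mulrC.
rewrite TE det_mulmx normrM det_map_mx -intr_norm.
by case/orP: (uT : (\det T == 1) || (\det T == -1)) => /eqP ->;
  rewrite ?normrN1 ?normr1 mul1r.
Qed.

Lemma vol_set0 (R : realType) (N : nat) : vol (set0 : set 'rV[R]_N) = 0%E.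
Proof.
elim: N => [|n IHn] /=; first by rewrite indic0.
by apply: integral0_eq => x _; rewrite -[RHS]IHn; congr vol; apply/seteqP.
Qed.

Lemma vol_closed_box (R : realType) (N : nat) (a b : 'I_N -> R) :
  (forall i, a i <= b i) ->
  vol [set x : 'rV[R]_N | forall i, a i <= x 0 i <= b i]
  = (\prod_i (b i - a i))%:E.
Proof.
elim: N a b => [|n IHn] a b ab /=.
  by rewrite big_ord0 indicE mem_set// => -[].
rewrite big_ord_recl; set c := \prod_(i < n) _.
have slice (x : R) (y : 'rV[R]_n) : [set y : 'rV[R]_n.+1 | forall i,
    a i <= y 0 i <= b i] (row_mx (const_mx x : 'rV[R]_1) y) <->
    a ord0 <= x <= b ord0 /\
    forall j, a (lift ord0 j) <= y 0 j <= b (lift ord0 j).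
  have E0 : (row_mx (const_mx x : 'rV[R]_1) y : 'rV[R]_n.+1) 0 ord0 = x.
    have <- : lshift n (ord0 : 'I_1) = ord0 :> 'I_n.+1 by apply: val_inj.
    by apply: etrans (row_mxEl _ _ _ _) _; rewrite mxE.
  have ES j : (row_mx (const_mx x : 'rV[R]_1) y : 'rV[R]_n.+1) 0 (lift ord0 j)
      = y 0 j.
    have <- : rshift 1 j = lift ord0 j :> 'I_n.+1 by apply: val_inj.
    exact: row_mxEr.
  split=> [h|[h0 hS] i].
    by split=> [|j]; [have := h ord0; rewrite E0|
      have := h (lift ord0 j); rewrite ES].
  by case: (unliftP ord0 i) => [j|] ->; rewrite ?E0 ?ES.
transitivity (\int[@lebesgue_measure R]_(x in [set: R])
    ((fun=> c%:E) \_ `[a ord0, b ord0]) x)%E.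
  apply: eq_integral.
  move=> x _; rewrite patchE; case: ifPn => [|];
    rewrite ?inE ?notin_setE/= in_itv/=.
  - move=> xab; rewrite /c -(IHn (a \o lift ord0) (b \o lift ord0));
      last by move=> j; exact: ab.
    congr vol; apply/seteqP; split=> y; first by case/slice.
    by move=> hy; apply/slice.
  - move=> xab; apply: etrans (vol_set0 R n); congr vol.
    apply/seteqP; split=> y //.
    by case/slice => /xab.
rewrite -integral_mkcond integral_cst//= lebesgue_measure_itv/= lte_fin.
rewrite [in RHS]mulrC EFinM; case: ltP => [//|ba]; congr (_ * _)%E.
by rewrite (le_anti (introT andP (conj ba (ab ord0)))) subrr.
Qed.

Lemma vol_translate_box (R : realType) (N : nat) (Q : 'I_N -> R)
    (t : 'rV[R]_N) : (forall i, 0 < Q i) ->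
  vol (translate t (centered_box Q)) = (\prod_i (2 * Q i))%:E.
Proof.
move=> Q0; transitivity (vol [set x : 'rV[R]_N |
    forall i, t 0 i - Q i <= x 0 i <= t 0 i + Q i]).
  congr vol; apply/seteqP; split=> [_ [x xQ <-] i|x xQ].
    by have := xQ i; rewrite mxE !lerD2l.
  exists (x - t); last by rewrite addrC subrK.
  by move=> i; rewrite !mxE lerBlDl lerBrDl; exact: xQ.
rewrite vol_closed_box => [|i]; last first.
  by rewrite lerD2l (le_trans _ (ltW (Q0 i)))// oppr_le0 ltW.
by congr EFin; apply: eq_bigr => i _; rewrite (addrC (t 0 i)) addrKA opprK
  mulr_natl mulr2n.
Qed.

(* Main.v *)
(** The diagonal map [x_i |-> (Qbar / Q_i) x_i] turns the box into a cube of half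
    side [Qbar] and preserves determinants; since the geometric mean bounds the
    sup norm from below, nonzero vectors of the dilated lattice have length at
    least [lam = Qbar / (Qbar / nu(B) + Qmax / B)].  So it suffices to bound the
    error for a cube of half side [r] by [N (2 K r / lam + 1)^(N-1)].

    Such a lattice has a basis [b] whose coordinate functionals have norm at most
    [K / lam], by induction on the rank: take an almost shortest vector, project
    it away, and size-reduce.  Moving the cube along [b_i] changes the number of
    lattice points by at most one on each line parallel to [b_i], and at most
    [(2 K r / lam + 1)^(N-1)] such lines carry lattice points of the cube; so the
    count is almost independent of the centre.  For a sublattice of a multiple of
    [Z^N], averaging over the cosets compares the count with the number of grid
    points of the cube; the general case follows by rational approximation of
    the basis. *)

Require Import Defs.
From HB Require Import structures.
From mathcomp Require Import all_boot all_order all_algebra.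
From mathcomp Require Import all_classical all_reals all_analysis.
From mathcomp Require Import ring lra zify finmap.

Import Order.TTheory GRing.Theory Num.Theory.
Import numFieldNormedType.Exports.

Local Open Scope classical_set_scope.
Local Open Scope card_scope.
Local Open Scope ring_scope.

Set Implicit Arguments.
Unset Strict Implicit.
Unset Printing Implicit Defensive.

(** * Reduced bases *)

Definition dotrv (R : pzRingType) (m : nat) (x y : 'rV[R]_m) : R :=
  \sum_i x 0 i * y 0 i.

Lemma dotrvC (R : comPzRingType) (m : nat) (x y : 'rV[R]_m) :
  dotrv x y = dotrv y x.
Proof. by apply: eq_bigr => i _; rewrite mulrC. Qed.

Lemma dotrvDl (R : pzRingType) (m : nat) (x y z : 'rV[R]_m) :
  dotrv (x + y) z = dotrv x z + dotrv y z.
Proof.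
by rewrite -big_split; apply: eq_bigr => i _; rewrite mxE mulrDl.
Qed.

Lemma dotrvZl (R : pzRingType) (m : nat) (a : R) (x y : 'rV[R]_m) :
  dotrv (a *: x) y = a * dotrv x y.
Proof. by rewrite mulr_sumr; apply: eq_bigr => i _; rewrite mxE mulrA. Qed.

Lemma dotrv_ge0 (R : realDomainType) (m : nat) (x : 'rV[R]_m) :
  0 <= dotrv x x.
Proof. by apply: sumr_ge0 => i _; rewrite -expr2 sqr_ge0. Qed.

Lemma dotrv_pythagoras (R : comPzRingType) (m : nat) (a : R) (u w : 'rV[R]_m) :
  dotrv w u = 0 ->
  dotrv (a *: u + w) (a *: u + w) = a ^+ 2 * dotrv u u + dotrv w w.
Proof.
move=> wu; rewrite dotrvDl dotrvZl 2!(dotrvC _ (_ + _)) !dotrvDl !dotrvZl.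
by rewrite (dotrvC u w) wu; ring.
Qed.

(** Projects away from [u], onto its orthogonal hyperplane, and acts on rows from the right. *)
Definition orthproj (F : fieldType) (m : nat) (u : 'rV[F]_m) : 'M[F]_m :=
  1%:M - (dotrv u u)^-1 *: (u^T *m u).

Lemma mul_orthproj (F : fieldType) (m : nat) (u y : 'rV[F]_m) :
  y *m orthproj u = y - (dotrv y u / dotrv u u) *: u.
Proof.
rewrite mulmxBr mulmx1 -scalemxAr mulmxA; congr (_ - _).
rewrite [y *m _]mx11_scalar mul_scalar_mx scalerA mulrC; congr (_ / _ *: _).
by rewrite mxE; apply: eq_bigr => i _; rewrite mxE.
Qed.

Lemma orthproj_orth (F : fieldType) (m : nat) (u y : 'rV[F]_m) :
  dotrv u u != 0 -> dotrv (y *m orthproj u) u = 0.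
Proof.
by move=> u0; rewrite mul_orthproj -scaleNr dotrvDl dotrvZl mulNr divfK ?subrr.
Qed.

Lemma near_round (R : realType) (x : R) : exists n : int, `|x - n%:~R| <= 2^-1.
Proof.
exists (Num.floor (x + 2^-1)); have := floor_le (x + 2^-1).
have := floorD1_gt (x + 2^-1); rewrite intrD => h1 h2.
by rewrite ler_norml; apply/andP; split; lra.
Qed.

Lemma sum_sqr_le (R : realDomainType) (k : nat) (a : 'I_k -> R) (K : R) :
  (forall i, a i ^+ 2 <= K) -> (\sum_i a i) ^+ 2 <= k%:R ^+ 2 * K.
Proof.
case: k a => [|k] a aK; first by rewrite big_ord0 expr0n mul0r.
have K0 : 0 <= K by apply: le_trans (aK ord0); rewrite sqr_ge0.
have [j _ jmax] := @arg_maxP _ _ _ ord0 predT (fun i => `|a i|) isT.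
have : `|\sum_i a i| <= k.+1%:R * `|a j|.
  apply: le_trans (ler_norm_sum _ _ _) _.
  apply: (@le_trans _ _ (\sum_(i < k.+1) `|a j|)).
    by apply: ler_sum => i _; exact: jmax.
  by rewrite sumr_const card_ord mulr_natl.
rewrite -(@ler_pXn2r _ 2)// ?nnegrE ?mulr_ge0// exprMn => h.
rewrite -(real_normK (num_real (\sum_i _))) (le_trans h)//.
by rewrite ler_wpM2l ?exprn_ge0// real_normK ?num_real.
Qed.

(** The infimum of the squared lengths is at least [lam ^+ 2 > 0], so some value lies below twice
    the infimum. The factor 2 makes it unnecessary to show that a minimum is attained. *)
Lemma exists_near_shortest (R : realType) (k m : nat) (A : 'M[R]_(k.+1, m))
    (lam : R) : 0 < lam ->
  (forall z : 'rV[int]_k.+1, z != 0 ->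
    lam ^+ 2 <= dotrv (map_mx intr z *m A) (map_mx intr z *m A)) ->
  exists2 e : 'rV[int]_k.+1, e != 0 & forall z : 'rV[int]_k.+1, z != 0 ->
    dotrv (map_mx intr e *m A) (map_mx intr e *m A)
    <= 2 * dotrv (map_mx intr z *m A) (map_mx intr z *m A).
Proof.
move=> lam0 Alam.
pose q (z : 'rV[int]_k.+1) := dotrv (map_mx intr z *m A) (map_mx intr z *m A).
pose E := [set q z | z in [set z | z != 0]].
have lbE : lbound E (lam ^+ 2) by move=> _ [z z0 <-]; exact: Alam.
have hE : has_inf E.
  split; last by exists (lam ^+ 2).
  exists (q (const_mx 1)), (const_mx 1) => //=.
  by apply/eqP => /rowP/(_ 0); rewrite !mxE.
have infE0 : 0 < inf E.
  by apply: lt_le_trans (lb_le_inf (proj1 hE) lbE); rewrite exprn_gt0.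
have [_ [e e0 <-] eE] := inf_adherent infE0 hE.
exists e => // z z0; apply: le_trans (ltW eE) _.
have : inf E <= q z by apply: ge_inf; [exact: proj2 hE|exists z].
by rewrite -/(q z); lra.
Qed.

(** The Smith normal form of the one-row matrix [e] has a scalar left factor and a single elementary
    divisor; its right factor is [V]. Thus the primitive vector underlying [e] extends to a basis of
    the integer lattice. *)
Lemma exists_basis_row (k : nat) (e : 'rV[int]_k.+1) :
  exists (a : int) (V : 'M[int]_k.+1), V \in unitmx /\ e = a *: row 0 V.
Proof.
have [L _ [V Vu [d _ ->]]] := int_Smith_normal_form e.
exists (L 0 0 * d`_0), V; split=> //; rewrite [L in LHS]mx11_scalar mul_scalar_mx.
rewrite -scalemxAl -scalerA; congr (_ *: _); rewrite rowE scalemxAl.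
congr (_ *m _); apply/rowP => j; rewrite !mxE eqxx /=.
have -> : (0 == j :> nat) = (j == 0) by rewrite eq_sym.

by rewrite mulr_natr.
Qed.

Lemma dotrv_mull (R : comPzRingType) (k m : nat) (c : 'rV[R]_k)
    (W : 'M[R]_(k, m)) (u : 'rV[R]_m) :
  dotrv (c *m W) u = \sum_i c 0 i * dotrv (row i W) u.
Proof.
rewrite /dotrv.
under eq_bigr do rewrite mxE mulr_suml.
rewrite exchange_big; apply: eq_bigr => i _.
by rewrite mulr_sumr; apply: eq_bigr => j _; rewrite mxE mulrA.
Qed.

(** Induction on the rank [k]: a nearly shortest primitive vector [u] comes first, the rest is
    projected orthogonally to [u] and reduced by induction, and the lifts are size-reduced against
    [u]. The ambient dimension [m] is free because the projected lattice loses rank but stays in the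
    same space. *)
Lemma reduced_basis (R : realType) (k : nat) : exists2 C : R, 0 <= C &
  forall (m : nat) (A : 'M[R]_(k, m)) (lam : R), 0 < lam ->
    (forall z : 'rV[int]_k, z != 0 ->
      lam ^+ 2 <= dotrv (map_mx intr z *m A) (map_mx intr z *m A)) ->
    exists2 U : 'M[int]_k, U \in unitmx & forall (c : 'rV[R]_k) j,
      lam ^+ 2 * c 0 j ^+ 2
      <= C * dotrv (c *m (map_mx intr U *m A)) (c *m (map_mx intr U *m A)).
Proof.
elim: k => [|k [C C0 IH]].
  exists 0 => // m A lam _ _; exists 1%:M; first exact: unitmx1.
  by move=> c [].
(* The later coordinates cost [4 * C], because the induction hypothesis is used with [lam / 2]; the
   first one costs [2 + 2 * k ^+ 2 * C]. The sum covers both. *)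
exists (2 + 4 * C + 2 * k%:R ^+ 2 * C); first by rewrite !addr_ge0 ?mulr_ge0 ?exprn_ge0.
move=> m A lam lam0 Alam.
have [e e0 emin] := exists_near_shortest lam0 Alam.
have [a [V [Vu eV]]] := exists_basis_row e.
have a0 : a != 0 by apply: contraNneq e0 => a0; rewrite eV a0 scale0r.
pose v : 'rV[int]_k.+1 := row 0 V.
have v0 : v != 0 by apply: contraNneq e0; rewrite eV -/v => ->; rewrite scaler0.
pose D : 'M[int]_(k, 1 + k) := dsubmx (V : 'M[int]_(1 + k)).
have VE : V = col_mx v D :> 'M[int]_(1 + k).
  rewrite -[LHS](@vsubmxK _ 1 k (1 + k)); congr col_mx; apply/matrixP => i j.
  by rewrite !mxE ord1; congr (V _ _); apply: val_inj.
pose u : 'rV[R]_m := map_mx intr v *m A; pose p := dotrv u u.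
(* Passing from [e = a *: v] to the primitive [v] only shortens the vector, since [a] is a nonzero
   integer. *)
have pmin z : z != 0 -> p <= 2 * dotrv (map_mx intr z *m A) (map_mx intr z *m A).
  move=> z0; apply: le_trans (emin z z0).
  rewrite eV -/v map_mxZ -scalemxAl -/u dotrvZl dotrvC dotrvZl -/p mulrA -expr2.
  apply: ler_peMl; first exact: dotrv_ge0.
  by rewrite -rmorphXn/= (ler_int _ 1) -gtz0_ge1 exprn_even_gt0.
have lamp : lam ^+ 2 <= p by exact: Alam.
have p0 : 0 < p by apply: lt_le_trans lamp; rewrite exprn_gt0.
pose W : 'M[R]_(k, m) := map_mx intr D *m A.
(* A projected vector has a lift whose component along [u] is at most half of [u]. By [pmin] and
   Pythagoras, [p <= 2 * (p / 4 + T)] where [T] is the squared length of the projection, so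
   [T >= p / 4 >= (lam / 2) ^+ 2]. *)
have [||U' U'u U'C] := IH m (W *m orthproj u) (lam / 2); first by rewrite divr_gt0.
  move=> z z0; rewrite mulmxA mul_orthproj.
  set y := map_mx intr z *m W; set mu := dotrv _ _ / _.
  have [n nmu] := near_round mu.
  pose z1 : 'rV[int]_(1 + k) := row_mx (- n)%:M z.
  have z1V : map_mx intr (z1 *m V) *m A = (mu - n%:~R) *: u + (y - mu *: u).
    rewrite VE mul_row_col mul_scalar_mx map_mxD map_mxZ map_mxM mulmxDl.
    by rewrite -scalemxAl -/u -mulmxA -/W -/y; apply/rowP => i; rewrite !mxE rmorphN/=; ring.
  have z1V0 : z1 *m V != 0.
    apply: contraNneq z0 => /(congr1 (mulmx^~ (invmx V))).
    rewrite mulmxK// mul0mx => /rowP z10; apply/eqP/rowP => i.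
    rewrite -[LHS](row_mxEr (- n)%:M z 0 i).
    by apply: etrans (z10 (rshift 1 i)) _; rewrite !mxE.
  have := pmin _ z1V0; rewrite z1V dotrv_pythagoras; last first.
    by rewrite -(mul_orthproj u y) orthproj_orth// gt_eqF.
  rewrite -/p => pz; have nn : (mu - n%:~R) ^+ 2 <= 4^-1.
    have -> : (4^-1 : R) = 2^-1 ^+ 2 by field.
    by rewrite -(real_normK (num_real (_ - _))) ler_pXn2r ?nnegrE.
  have : (mu - n%:~R) ^+ 2 * p <= 4^-1 * p by rewrite ler_pM2r.
  by rewrite expr_div_n; lra.
pose W' := map_mx intr U' *m W.
(* Size reduction: subtracting [n i] times [u] from the [i]-th lifted vector leaves a component
   [dl i] along [u] of size at most one half. *)
have [n nW] : {n : 'I_k -> int & forall i,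
    `|dotrv (row i W') u / p - (n i)%:~R| <= 2^-1}.
  by apply: (@choice _ _ (fun i n => `|dotrv (row i W') u / p - n%:~R| <= 2^-1))
    => i; exact: near_round.
pose nu0 : 'cV[int]_k := \col_i n i.
pose U : 'M[int]_(1 + k) := block_mx 1%:M 0 (- nu0) U' *m V.
exists U.
  rewrite /U unitmx_mul Vu andbT unitmxE [\det _](det_lblock 1%:M (- nu0) U').
  by rewrite det1 mul1r -unitmxE.
have ApE : map_mx intr U *m A = col_mx u (W' - map_mx intr nu0 *m u) :> 'M[R]_(1 + k, m).
  rewrite /U VE mul_block_col mul1mx mul0mx addr0 map_col_mx mul_col_mx -/u.
  congr col_mx; rewrite mulNmx addrC map_mxD map_mxN !map_mxM mulmxDl mulNmx.
  by rewrite -!mulmxA.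
move=> c; pose c1 := c 0 0; pose c' : 'rV[R]_k := rsubmx (c : 'rV[R]_(1 + k)).
pose dl i := dotrv (row i W') u / p - (n i)%:~R.
(* The coefficient along [u] of the vector with coordinates [c]; the remaining part of that vector
   is orthogonal to [u]. *)
pose s := c1 + \sum_i c' 0 i * dl i.
set S := dotrv (c *m _) _.
have cE : c = row_mx c1%:M c' :> 'rV[R]_(1 + k).
  rewrite -[LHS](@hsubmxK _ 1 1 k); congr row_mx.
  by apply/matrixP => i j; rewrite !mxE !ord1; congr (c _ _); apply: val_inj.
have cA : c *m (map_mx intr U *m A) = c1 *: u + c' *m (W' - map_mx intr nu0 *m u).
  rewrite ApE [c in LHS]cE -mul_scalar_mx.
  exact: (mul_row_col c1%:M c' u (W' - map_mx intr nu0 *m u)).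
have SE : S = s ^+ 2 * p + dotrv (c' *m (map_mx intr U' *m (W *m orthproj u)))
    (c' *m (map_mx intr U' *m (W *m orthproj u))).
  have po : c' *m (map_mx intr U' *m (W *m orthproj u)) = (c' *m W') *m orthproj u.
    by rewrite /W' !mulmxA.
  rewrite -dotrv_pythagoras po; last by rewrite orthproj_orth// gt_eqF.
  have -> : s *: u + c' *m W' *m orthproj u = c *m (map_mx intr U *m A).
    rewrite mul_orthproj dotrv_mull -/p cA.
    have -> : s = c1 + (\sum_i c' 0 i * dotrv (row i W') u) / p
        - (c' *m map_mx intr nu0) 0 0.
      rewrite /s -addrA; congr (_ + _); rewrite mxE mulr_suml -sumrB.
      by apply: eq_bigr => i _; rewrite !mxE /dl; ring.
    rewrite mulmxBr mulmxA [in RHS](mx11_scalar (c' *m map_mx intr nu0)) mul_scalar_mx.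
    by apply/rowP => i; rewrite !mxE; ring.
  by [].
have Sc' j : lam ^+ 2 * c' 0 j ^+ 2 <= 4 * C * S.
  have := U'C c' j; set T := dotrv _ _ in SE *; rewrite expr_div_n => h.
  have : C * T <= C * S by rewrite ler_wpM2l// SE lerDr mulr_ge0 ?sqr_ge0// ltW.
  by lra.
have S0 : 0 <= S by exact: dotrv_ge0.
have CS0 : 0 <= C * S by rewrite mulr_ge0.
have kCS0 : 0 <= k%:R ^+ 2 * (C * S) by rewrite mulr_ge0 ?exprn_ge0.
move=> j; case: (unliftP ord0 j) => [i|] ->.
  have -> : c 0 (lift ord0 i) = c' 0 i.
    by rewrite mxE; congr (c _ _); apply: val_inj.
  by have := Sc' i; nra.
rewrite -/c1; have slam : lam ^+ 2 * s ^+ 2 <= S.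
  rewrite SE mulrC; apply: ler_wpDr; first exact: dotrv_ge0.
  by rewrite ler_wpM2l ?sqr_ge0.
(* The factor [4] in [Sc'] cancels against [dl i ^+ 2 <= 1 / 4]. The first coordinate is then
   recovered as [s] minus this sum (without [lam]), using
   [(x - y) ^+ 2 <= 2 * x ^+ 2 + 2 * y ^+ 2]. *)
have h : (\sum_i lam * (c' 0 i * dl i)) ^+ 2 <= k%:R ^+ 2 * (C * S).
  apply: sum_sqr_le => i.
  have dl2 : dl i ^+ 2 <= 4^-1.
    have -> : (4^-1 : R) = 2^-1 ^+ 2 by field.
    by rewrite -(real_normK (num_real (dl i))) ler_pXn2r ?nnegrE//; exact: nW.
  have := Sc' i; rewrite !exprMn mulrA => h.
  have : lam ^+ 2 * c' 0 i ^+ 2 * dl i ^+ 2 <= lam ^+ 2 * c' 0 i ^+ 2 * 4^-1.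
    by rewrite ler_wpM2l// mulr_ge0 ?sqr_ge0.
  by lra.
rewrite -mulr_sumr in h.
have : lam ^+ 2 * c1 ^+ 2 <= 2 * (lam ^+ 2 * s ^+ 2) + 2 * (lam * (\sum_i c' 0 i * dl i)) ^+ 2.
  have -> : c1 = s - \sum_i c' 0 i * dl i by rewrite /s addrK.
  set t := \sum_i _; have := sqr_ge0 (lam * (s + t)); nra.
by nra.
Qed.

(** * Counting *)

(* [0] when [A] is infinite. *)
Definition ncard (T : choiceType) (A : set T) : nat := size (fset_set A).

Lemma card_eq_ncard (T : choiceType) (A : set T) :
  finite_set A -> A #= `I_(ncard A).
Proof. by case=> n An; rewrite /ncard (card_fset_set An). Qed.

Lemma ncard_inj (T U : choiceType) (A : set T) (B : set U) (f : T -> U) :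
  finite_set B -> (forall x, A x -> B (f x)) -> {in A &, injective f} ->
  finite_set A /\ (ncard A <= ncard B)%N.
Proof.
move=> Bfin AB fI.
have AleB : A #<= B.
  rewrite -(card_le_eql (inj_card_eq fI)); apply: subset_card_le.
  by move=> _ [x Ax <-]; exact: AB.
split; first exact: card_le_finite AleB Bfin.
apply: geq_card_fset_set; apply: card_le_trans AleB _.
by rewrite (card_le_eql (card_eq_ncard Bfin)).
Qed.

Lemma ncardS (T : choiceType) (A B : set T) :
  finite_set B -> A `<=` B -> (ncard A <= ncard B)%N.
Proof. by move=> Bfin AB; apply: (proj2 (@ncard_inj _ _ _ _ id _ _ _)). Qed.

Lemma ncardU (T : choiceType) (A B : set T) : finite_set A -> finite_set B ->
  (ncard (A `|` B) <= ncard A + ncard B)%N.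
Proof.
by move=> Afin Bfin; rewrite /ncard fset_setU// cardfsU leq_subr.
Qed.

Lemma ncard_range (T : finType) (U : choiceType) (f : T -> U) :
  injective f -> finite_set (range f) /\ ncard (range f) = #|T|.
Proof.
move=> fI; have rE : range f #= `I_#|T|.
  apply: (card_eq_trans (@inj_card_eq _ _ setT f _)); first by move=> x y _ _; exact: fI.
  apply: card_eq_trans (card_esym (@card_II #|T|)).
  rewrite -(_ : range (@enum_val T predT) = setT).
    by apply: inj_card_eq => x y _ _; exact: enum_val_inj.
  by apply/seteqP; split=> // x _; exists (enum_rank x); rewrite ?enum_rankK.
split; last exact: card_fset_set.
by exists #|T|%N.
Qed.

(** The maps [h i] carry the sets [F i] bijectively onto disjoint pieces that exhaust [G]. It serves
    to split grid points into cosets of a sublattice. *)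
Lemma ncard_partition (I : finType) (T U : choiceType) (G : set T)
    (F : I -> set U) (h : I -> U -> T) :
  finite_set G -> (forall i, finite_set (F i)) ->
  (forall i u, F i u -> G (h i u)) ->
  (forall x, G x -> exists i u, F i u /\ h i u = x) ->
  (forall i j u v, F i u -> F j v -> h i u = h j v -> i = j /\ u = v) ->
  ncard G = (\sum_i ncard (F i))%N.
Proof.
move=> Gfin Ffin FG GF hI.
(* The index function [idx] needs a default value outside [G]. If every [F i] is empty, so is [G],
   and both sides vanish. *)
have [[i0 [u0 F0]]|noF] := pselect (exists i u, F i u); last first.
  rewrite big1 => [|i _].
    rewrite (_ : G = set0) ?/ncard ?fset_set0//; apply/seteqP; split=> // x /GF.
    by case=> i [u [iu _]]; apply: noF; exists i, u.
  rewrite (_ : F i = set0) ?/ncard ?fset_set0//; apply/seteqP; split=> // u iu.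
  by apply: noF; exists i, u.
have [idx idxE] : {idx : T -> I & forall x, G x -> exists u, F (idx x) u /\ h (idx x) u = x}.
  apply: (@choice _ _ (fun x i => G x -> exists u, F i u /\ h i u = x)) => x.
  by have [/GF[i iu]|nG] := pselect (G x); [exists i|exists i0 => /nG].
rewrite /ncard -sum1_size (partition_big idx predT)//=; apply: eq_bigr => i _.
rewrite sum1_count -size_filter -[RHS](size_map (h i)); apply: perm_size.
apply: uniq_perm.
- by rewrite filter_uniq// fset_uniq.
- rewrite map_inj_in_uniq ?fset_uniq// => u v.
  rewrite !in_fset_set// => /set_mem iu /set_mem iv huv.
  by have [] := hI _ _ _ _ iu iv huv.
move=> x; rewrite mem_filter in_fset_set//; apply/idP/mapP.
- move=> /andP[/eqP <- /set_mem/idxE[u [iu hu]]].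
  by exists u => //; rewrite in_fset_set//; exact: mem_set.
- move=> [u]; rewrite in_fset_set// => /set_mem iu ->.
  have Gh := FG _ _ iu; rewrite [_ \in G]mem_set// andbT.
  have [v [Fv hv]] := idxE _ Gh.
  by have [->] := hI _ _ _ _ Fv iu hv.
Qed.

(** * Integer points in boxes, and lattice points in a moving cube *)

Lemma int_in_interval (R : realType) (t r : R) : 0 <= r -> exists m : nat,
  [/\ 2 * r - 1 <= m%:R, m%:R <= 2 * r + 1 & forall k : int,
    `|k%:~R - t| <= r <->
    exists2 i : 'I_m, True & k = Num.ceil (t - r) + i%:Z].
Proof.
move=> r0; set a := Num.ceil (t - r); set b := Num.floor (t + r).
have a1 := ceil_ge (t - r); have a2 := ceilB1_lt (t - r).
have b1 := floor_le (t + r); have b2 := floorD1_gt (t + r).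
rewrite -/a -/b in a1 a2 b1 b2; rewrite intrB in a2; rewrite intrD in b2.
(* For [r < 1 / 2] the interval may contain no integer; then [a = b + 1] and the length formula
   still gives the right count, zero. *)
have ab : 0 <= b - a + 1.
  have : (a%:~R - 1 : R) < (b + 1)%:~R by rewrite intrD; lra.
  by rewrite -[X in _ - X]/(1%:~R) -intrB ltr_int; lia.
exists (absz (b - a + 1)); have mE : (absz (b - a + 1))%:R = b%:~R - a%:~R + 1 :> R.
  by rewrite natr_absz ger0_norm// intrD intrB.
rewrite mE; split=> [||k]; [lra|lra|].
have -> : (`|k%:~R - t| <= r) = (a <= k <= b).
  rewrite /a /b ceil_le_int floor_ge_int ler_norml.
  by congr andb; apply/idP/idP; lra.
split=> [/andP[ak kb]|[i _ ->]].
  have h : leq (absz (k - a)).+1 (absz (b - a + 1)) by lia.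
  by exists (Ordinal h) => //=; lia.
by have := ltn_ord i; lia.
Qed.

(** The radii may differ, so that a coordinate can be frozen by giving it radius zero. *)
Lemma card_int_box (R : realType) (N : nat) (t r : 'I_N -> R) :
  (forall i, 0 <= r i) -> exists m : 'I_N -> nat,
  let G := [set z : 'rV[int]_N | forall i, `|(z 0 i)%:~R - t i| <= r i] in
  [/\ forall i, 2 * r i - 1 <= (m i)%:R <= 2 * r i + 1, finite_set G
    & ncard G = (\prod_i m i)%N].
Proof.
move=> r0; have [m mE] := choice (fun i => @int_in_interval R (t i) (r i) (r0 i)).
exists m; pose f (g : {dffun forall i, 'I_(m i)}) : 'rV[int]_N :=
  \row_i (Num.ceil (t i - r i) + (g i : nat)%:Z).
have fI : injective f.
  move=> g h /rowP gh; apply/ffunP => i; apply: val_inj.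
  by have := gh i; rewrite !mxE => /addrI[].
have -> : [set z : 'rV[int]_N | forall i, `|(z 0 i)%:~R - t i| <= r i] = range f.
  apply/seteqP; split=> [z zG|_ [g _ <-] i]; last first.
    by have [_ _ h] := mE i; apply/h; exists (g i); rewrite ?mxE.
  have zg i : exists j : 'I_(m i), z 0 i = Num.ceil (t i - r i) + (j : nat)%:Z.
    by have [_ _ h] := mE i; have /h[j _ ->] := zG i; exists j.
  exists [ffun i => sval (cid (zg i))] => //; apply/rowP => i.
  by rewrite mxE ffunE -(svalP (cid (zg i))).
have [rfin rcard] := ncard_range fI.
split=> //; first by move=> i; have [-> ->] := mE i.
rewrite rcard card_dep_ffun foldrE big_image /=.
by apply: eq_bigr => i _; rewrite card_ord.
Qed.

(** Lattice points of a cube are recorded by their integer coordinates, so that the sets for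
    different bases can be compared by inclusion. *)
Definition cube_points (R : realType) (N : nat) (B : 'M[R]_N) (t : 'rV[R]_N)
    (r : R) : set 'rV[int]_N :=
  [set z | forall i, `|(map_mx intr z *m B - t) 0 i| <= r].

Definition coords_le (R : realType) (N : nat) (B : 'M[R]_N) (kap : R) : Prop :=
  forall (c : 'rV[R]_N) (rho : R), (forall i, `|(c *m B) 0 i| <= rho) ->
    forall j, `|c 0 j| <= kap * rho.

Lemma coords_le_unit (R : realType) (N : nat) (B : 'M[R]_N) (kap : R) :
  coords_le B kap -> B \in unitmx.
Proof.
move=> hB; rewrite -row_free_unit; apply: inj_row_free => v vB0.
apply/rowP => j; rewrite mxE; apply/eqP; rewrite -normr_le0 -(mulr0 kap).
by apply: hB => i; rewrite vB0 mxE normr0.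
Qed.

Lemma cube_points_coords (R : realType) (N : nat) (B : 'M[R]_N) (t : 'rV[R]_N)
    (kap r : R) (z : 'rV[int]_N) : coords_le B kap -> cube_points B t r z ->
  forall j, `|(z 0 j)%:~R - (t *m invmx B) 0 j| <= kap * r.
Proof.
move=> hB zS j; have := hB (map_mx intr z - t *m invmx B) r _ j.
rewrite mulmxBl mulmxKV; last exact: coords_le_unit hB.
by rewrite !mxE; apply.
Qed.

Lemma cube_points_finite (R : realType) (N : nat) (B : 'M[R]_N) (t : 'rV[R]_N)
    (kap r : R) : coords_le B kap -> 0 <= kap * r ->
  finite_set (cube_points B t r).
Proof.
move=> hB kr0.
have [m [_ Gfin _]] := @card_int_box R N (fun i => (t *m invmx B) 0 i)
  (fun=> kap * r) (fun=> kr0).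
by apply: sub_finite_set Gfin => z; exact: cube_points_coords.
Qed.

(* Translating the cube by [f *: row i B] changes the count by at most one on
   each line parallel to [row i B], by convexity. *)
Lemma ncard_cube_shift_row (R : realType) (N : nat) (B : 'M[R]_N)
    (t : 'rV[R]_N) (kap r f : R) (i : 'I_N) : coords_le B kap -> 0 <= kap * r ->
  0 <= f <= 1 ->
  (ncard (cube_points B t r))%:R
  <= (ncard (cube_points B (t + f *: row i B) r))%:R
     + (2 * (kap * r) + 1) ^+ N.-1 :> R.
Proof.
move=> hB kr0 /andP[f0 f1].
pose S := cube_points B t r; pose e : 'rV[int]_N := delta_mx 0 i.
have eB (n : int) z k : (map_mx intr (z + n *: e) *m B - t) 0 k
    = (map_mx intr z *m B - t) 0 k + n%:~R * B i k.
  rewrite map_mxD map_mxZ map_delta_mx mulmxDl -scalemxAl -rowE !mxE.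
  by ring.
(* [Sb] collects the last point of the cube on each line parallel to [row i B]. *)
pose Sa := [set z | S z /\ S (z + e)]; pose Sb := [set z | S z /\ ~ S (z + e)].
have Sfin : finite_set S by exact: cube_points_finite hB kr0.
have Safin : finite_set Sa by apply: sub_finite_set Sfin => z [].
have Sbfin : finite_set Sb by apply: sub_finite_set Sfin => z [].
have SE : (ncard S <= ncard Sa + ncard Sb)%N.
  apply: leq_trans (ncardU Safin Sbfin); apply: ncardS.
    by rewrite finite_setU.
  by move=> z Sz; have [?|?] := pselect (S (z + e)); [left|right].
(* If the points of [z] and [z + e] both lie in the cube, so does the intermediate point obtained by
   moving that of [z + e] back by [f *: row i B]. Hence [z + e] is counted by the shifted cube. *)
have Sa_le : (ncard Sa <= ncard (cube_points B (t + f *: row i B) r))%N.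
  apply: (proj2 (@ncard_inj _ _ _ _ (fun z => z + e) _ _ _)).
  - exact: cube_points_finite hB kr0.
  - move=> z [Sz Sze] k; have := Sz k; have := Sze k.
    have -> (x : 'rV[R]_N) : (x - (t + f *: row i B)) 0 k = (x - t) 0 k - f * B i k.
      by rewrite !mxE; ring.
    rewrite -[e]scale1r eB mul1r !ler_norml; set x := (_ - t) 0 k.
    by move=> /andP[? ?] /andP[? ?]; apply/andP; split; nra.
  - by move=> z w _ _; exact: addIr.
(* The [i]-th coordinate is frozen at zero, so this box parametrises the lines; its factor [m i] is
   at most one, which gives the exponent [N.-1]. *)
have [m [m_le Gfin Gcard]] := @card_int_box R N
  (fun j => if j == i then 0 else (t *m invmx B) 0 j)
  (fun j => if j == i then 0 else kap * r)
  (fun j => match j == i as b return 0 <= (if b then 0 else kap * r) with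
            | true => lexx 0 | false => kr0 end).
have Sb_le : (ncard Sb <= \prod_j m j)%N.
  rewrite -Gcard.
  pose flat (z : 'rV[int]_N) : 'rV[int]_N := \row_j (if j == i then 0 else z 0 j).
  apply: (proj2 (@ncard_inj _ _ Sb _ flat Gfin _ _)).
    move=> z [Sz _] j; rewrite mxE; case: eqP => _; first by rewrite subr0 normr0.
    exact: cube_points_coords hB Sz j.
  (* Of two points of [Sb] on one line, the lower one would have its successor between the two,
     hence in the cube by convexity. *)
  have suff_le z w : Sb z -> Sb w -> (forall j, j != i -> z 0 j = w 0 j) ->
      (z 0 i < w 0 i) -> False.
    move=> [Sz nSz] [Sw _] zw zwi; apply: nSz => k.
    have wE : w = z + (w 0 i - z 0 i) *: e.
      apply/rowP => j; rewrite !mxE eqxx /=; case: (eqVneq j i) => [->|ji].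
        by rewrite mulr1 addrC subrK.
      by rewrite mulr0 addr0 zw.
    have := Sz k; have := Sw k; rewrite wE eB.
    rewrite -[in X in _ -> _ -> X](scale1r e) eB mul1r.
    have : (1 : R) <= (w 0 i - z 0 i)%:~R by rewrite -[1]/(1%:~R) ler_int; lia.
    rewrite !ler_norml; set x := (_ - t) 0 k; set d := _%:~R => d1.
    by move=> /andP[? ?] /andP[? ?]; apply/andP; split; nra.
  move=> z w /set_mem Sz /set_mem Sw /rowP zw.
  have zw' j : j != i -> z 0 j = w 0 j.
    by move=> /negbTE ji; have := zw j; rewrite !mxE ji.
  apply/rowP => j; case: (eqVneq j i) => [->|]; last exact: zw'.
  case: (ltgtP (z 0 i) (w 0 i)) => // h.
    by case: (suff_le z w).
  by case: (suff_le w z) => // k ki; rewrite zw'.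
apply: (@le_trans _ _ ((ncard Sa)%:R + (ncard Sb)%:R)).
  by rewrite -natrD ler_nat.
apply: lerD; first by rewrite ler_nat.
apply: (@le_trans _ _ (\prod_j m j)%:R); first by rewrite ler_nat.
rewrite natr_prod (bigD1 i)//= [leLHS]mulrC.
have -> : (2 * (kap * r) + 1) ^+ N.-1
    = \prod_(j < N | j != i) (2 * (kap * r) + 1).
  by rewrite prodr_const cardC1 card_ord.
rewrite -[leRHS]mulr1; apply: ler_pM.
- by apply: prodr_ge0 => j _; rewrite ler0n.
- by rewrite ler0n.
- apply: ler_prod => j /negbTE ji; rewrite ler0n /=.
  by have := m_le j; rewrite ji => /andP[].
- by have := m_le i; rewrite eqxx mulr0 !add0r => /andP[].
Qed.

(** The displacement of the centre is expanded in the basis [B]. The fractional parts of the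
    coefficients are handled one row at a time, at [N] times the cost of one shift; the integral
    parts form a lattice vector, which translates the points without loss. *)
Lemma ncard_cube_shift (R : realType) (N : nat) (B : 'M[R]_N)
    (t t' : 'rV[R]_N) (kap r : R) : coords_le B kap -> 0 <= kap * r ->
  (ncard (cube_points B t r))%:R
  <= (ncard (cube_points B t' r))%:R
     + N%:R * (2 * (kap * r) + 1) ^+ N.-1 :> R.
Proof.
move=> hB kr0; pose c := (t' - t) *m invmx B.
have tE : t' = t + c *m B.
  by rewrite /c mulmxKV ?(coords_le_unit hB)// addrC subrK.
clearbody c.
pose f i := c 0 i - (Num.floor (c 0 i))%:~R.
have f01 i : 0 <= f i <= 1.
  have := floor_le (c 0 i); have := floorD1_gt (c 0 i).
  by rewrite intrD /f => ? ?; apply/andP; split; lra.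
have sum_shift (s : seq 'I_N) (t0 : 'rV[R]_N) :
    (ncard (cube_points B t0 r))%:R
    <= (ncard (cube_points B (t0 + \sum_(i <- s) f i *: row i B) r))%:R
       + (size s)%:R * (2 * (kap * r) + 1) ^+ N.-1 :> R.
  elim: s t0 => [|i s IH] t0; first by rewrite big_nil mul0r !addr0.
  apply: le_trans (ncard_cube_shift_row t0 i hB kr0 (f01 i)) _.
  rewrite big_cons /= addrA -[(size s).+1%:R]natr1.
  by have := IH (t0 + f i *: row i B); lra.
apply: le_trans (sum_shift (index_enum 'I_N) t) _.
rewrite -[index_enum _]enumT size_enum_ord lerD2r ler_nat.
apply: (proj2 (@ncard_inj _ _ _ _ (fun z => z + \row_i Num.floor (c 0 i)) _ _ _)).
- exact: cube_points_finite hB kr0.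
- move=> z zS k.
  have cE : c = \row_i f i + map_mx intr (\row_i Num.floor (c 0 i)).
    by apply/rowP => j; rewrite !mxE /f subrK.
  have sE : \sum_(i <- enum 'I_N) f i *: row i B = (\row_i f i) *m B.
    by rewrite mulmx_sum_row enumT; apply: eq_bigr => i _; rewrite mxE.
  have := zS k; rewrite sE.
  suff -> : map_mx intr z *m B - (t + \row_i f i *m B)
      = map_mx intr (z + \row_i Num.floor (c 0 i)) *m B - t' by [].
  have -> : t' = t + (\row_i f i *m B + map_mx intr (\row_i Num.floor (c 0 i)) *m B).
    by rewrite -mulmxDl -cE.
  rewrite map_mxD mulmxDl.
  have cancelY (X Y T P : 'rV[R]_N) : X - (T + P) = X + Y - (T + (P + Y)).
    by apply/rowP => j; rewrite !mxE; ring.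
  exact: cancelY.
- by move=> z w _ _; exact: addIr.
Qed.

(** * Sublattices of the integer grid *)

Lemma absz_det_Smith (N : nat) (L V : 'M[int]_N) (d : 'I_N -> int) :
  L \in unitmx -> V \in unitmx ->
  absz (\det (L *m diag_mx (\row_i d i) *m V)) = (\prod_i absz (d i))%N.
Proof.
have det_unit (U : 'M[int]_N) : U \in unitmx -> absz (\det U) = 1%N.
  rewrite unitmxE => uU.
  by case/orP: (uU : (\det U == 1) || (\det U == -1)) => /eqP ->.
move=> Lu Vu; rewrite !det_mulmx det_diag !abszM !det_unit// mul1n muln1.
rewrite (big_morph absz abszM absz1).
by apply: eq_bigr => i _; rewrite mxE.
Qed.

(** The grid splits into [dt] cosets of the lattice spanned by [D]. Each coset meets the cube in the
    number of lattice points of a translated cube, which differs from [n] by at most [E]. Summing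
    over the cosets compares [n * dt] with the number of grid points in the cube. *)
Lemma ncard_integral_lattice (R : realType) (N : nat) (D : 'M[int]_N)
    (t : 'rV[R]_N) (kap r : R) :
  coords_le (map_mx intr D) kap -> 0 <= kap * r -> 1 <= 2 * r ->
  let n : R := (ncard (cube_points (map_mx intr D) t r))%:R in
  let E := N%:R * (2 * (kap * r) + 1) ^+ N.-1 in
  let dt : R := `|\det (map_mx intr D)| in
  n * dt <= (2 * r + 1) ^+ N + E * dt /\ (2 * r - 1) ^+ N <= (n + E) * dt.
Proof.
set B := map_mx intr D => hB kr0 r1; have r0 : 0 <= r by lra.
have Bu := coords_le_unit hB.
have [L Lu [V Vu [d0 _]]] := int_Smith_normal_form D.
pose d (i : 'I_N) := d0`_i.
have -> : \matrix_(i, j) (d0`_i *+ (i == j :> nat)) = diag_mx (\row_i d i).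
  by apply/matrixP => i j; rewrite !mxE.
move=> DE; pose m i := absz (d i).
have detD : absz (\det D) = (\prod_i m i)%N by rewrite DE absz_det_Smith.
have detD0 : \det D != 0.
  by move: Bu; rewrite unitmxE unitfE det_map_mx intr_eq0.
have d_neq0 i : d i != 0.
  have : absz (\det D) != 0%N by rewrite absz_eq0.
  by rewrite detD; apply: contraNneq => di0; rewrite (bigD1 i)//= /m di0 mul0n.
have DI : injective (fun z : 'rV[int]_N => z *m D).
  move=> z w /(congr1 (map_mx (intr : int -> R))); rewrite !map_mxM -/B.
  move/(can_inj (mulmxK Bu))/rowP => zw; apply/rowP => i.
  by have := zw i; rewrite !mxE => /intr_inj.
(* Since [D] is [L *m diag_mx _ *m V] with unimodular [L] and [V], the vectors [g_row g *m V] with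
   entries of [g] below [m i] represent the cosets. *)
pose I := {dffun forall i : 'I_N, 'I_(m i)}.
pose g_row (g : I) : 'rV[int]_N := \row_i (g i : nat)%:Z.
(* The coset is moved back onto the lattice, and the cube is moved with it. *)
pose F (g : I) := cube_points B (t - map_mx intr (g_row g *m V)) r.
have [M [M_le Gfin Gcard]] := @card_int_box R N (fun i => t 0 i) (fun=> r) (fun=> r0).
set G := [set z | _] in Gfin Gcard.
have GE (g : I) z : F g z <-> G (z *m D + g_row g *m V).
  have E0 : map_mx intr z *m B - (t - map_mx intr (g_row g *m V))
      = map_mx intr (z *m D + g_row g *m V) - t.
    by rewrite map_mxD [map_mx _ (z *m D)]map_mxM -/B opprB addrA.
  by split=> zF i; have := zF i; rewrite E0 !mxE.
have GF : ncard G = (\sum_g ncard (F g))%N.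
  apply: (@ncard_partition _ _ _ _ _ (fun g z => z *m D + g_row g *m V)) => //.
  - by move=> g; exact: cube_points_finite hB kr0.
  - by move=> g z /GE.
  - move=> x Gx; have [w wV] : exists w : 'rV[int]_N, w *m V = x.
      by exists (x *m invmx V); rewrite mulmxKV.
    (* Coordinatewise division by [d i]: the remainders name the coset, and the quotients, corrected
       by [invmx L], give the lattice point. *)
    have rem_lt i : leq (absz (modz (w 0 i) (d i))).+1 (m i).
      by have := ltz_mod (w 0 i) (d_neq0 i); have := modz_ge0 (w 0 i) (d_neq0 i); rewrite /m; lia.
    pose g : I := [ffun i => Ordinal (rem_lt i)].
    pose q : 'rV[int]_N := \row_i divz (w 0 i) (d i).
    exists g, (q *m invmx L).
    have xE : q *m invmx L *m D + g_row g *m V = x.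
      rewrite DE !mulmxA mulmxKV// -mulmxDl -wV.
      congr (_ *m V); rewrite mul_mx_diag; apply/rowP => i.
      by rewrite !mxE ffunE /= gez0_abs ?modz_ge0// -divz_eq.
    by split=> //; apply/GE; rewrite xE.
  move=> g h z w _ _ zw.
  have gh : g = h.
    have zw1 : z *m L *m diag_mx (\row_i d i) + g_row g
        = w *m L *m diag_mx (\row_i d i) + g_row h.
      apply: (can_inj (mulmxK Vu)); rewrite !mulmxDl.
      by move: zw; rewrite DE !mulmxA.
    apply/ffunP => i; apply: val_inj.
    move: (z *m L) (w *m L) zw1 => zL wL; rewrite !mul_mx_diag => /rowP/(_ i).
    rewrite !mxE.
    move=> /(congr1 (modz^~ (d i))); rewrite !modzMDl -!(modz_abs _ (d i)).
    by rewrite !modz_small ?lez_nat ?ltz_nat ?ltn_ord// => -[].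
  by split=> //; move: zw; rewrite gh => /addIr/DI.
have dtE : `|\det B| = #|{: I}|%:R.
  rewrite /B det_map_mx -intr_norm card_dep_ffun foldrE big_image /=.
  under eq_bigr do rewrite card_ord.
  by rewrite -detD pmulrn abszE.
have GR : (ncard G)%:R = \prod_i (M i)%:R :> R by rewrite Gcard natr_prod.
have GFR : (ncard G)%:R = \sum_(g : I) (ncard (F g))%:R :> R by rewrite GF natr_sum.
move=> n E dt; rewrite /dt dtE; split.
- apply: (@le_trans _ _ ((ncard G)%:R + E * #|{: I}|%:R)); last first.
    rewrite lerD2r GR -[X in _ ^+ X]card_ord -prodr_const.
    by apply: ler_prod => i _; rewrite ler0n; have /andP[] := M_le i.
  have -> : n * #|{: I}|%:R = \sum_(g : I) n by rewrite sumr_const mulr_natr.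
  have -> : E * #|{: I}|%:R = \sum_(g : I) E by rewrite sumr_const mulr_natr.
  rewrite GFR -big_split; apply: ler_sum => g _.
  exact: ncard_cube_shift.
- apply: (@le_trans _ _ (ncard G)%:R).
    rewrite GR -[X in _ ^+ X]card_ord -prodr_const.
    apply: ler_prod => i _; rewrite subr_ge0 r1 /=.
    by have /andP[] := M_le i.
  have -> : (n + E) * #|{: I}|%:R = \sum_(g : I) (n + E) by rewrite sumr_const mulr_natr.
  rewrite GFR; apply: ler_sum => g _.
  exact: ncard_cube_shift.
Qed.

(** * Rational approximation *)

Lemma cube_pointsZ (R : realType) (N : nat) (P : 'M[R]_N) (t : 'rV[R]_N)
    (a r : R) : 0 < a -> cube_points (a *: P) (a *: t) (a * r) = cube_points P t r.
Proof.
move=> a0; have E z i : (`|(map_mx intr z *m (a *: P) - a *: t) 0 i| <= a * r)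
    = (`|(map_mx intr z *m P - t) 0 i| <= r).
  by rewrite -scalemxAr -scalerBr mxE normrM gtr0_norm// ler_pM2l.
by apply/seteqP; split=> z zS i; have := zS i; rewrite E.
Qed.

(** Scaling by [x^-1] reduces to the integral case; [kap] gains a factor [x] and [r] a factor
    [x^-1], so [kap * r] and the error term stay the same. *)
Lemma ncard_rational_lattice (R : realType) (N : nat) (D : 'M[int]_N)
    (t : 'rV[R]_N) (kap r x : R) : 0 < x ->
  let P := x *: map_mx intr D in
  coords_le P kap -> 0 <= kap * r -> x <= 2 * r ->
  let n : R := (ncard (cube_points P t r))%:R in
  let E := N%:R * (2 * (kap * r) + 1) ^+ N.-1 in
  n * `|\det P| <= (2 * r + x) ^+ N + E * `|\det P| /\
  (2 * r - x) ^+ N <= (n + E) * `|\det P|.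
Proof.
move=> x0 P hP kr0 xr n E; have xn0 : x != 0 by rewrite gt_eqF.
have BE : map_mx intr D = x^-1 *: P by rewrite scalerA mulVf// scale1r.
have hB : coords_le (map_mx intr D) (kap * x).
  move=> c rho cB j; rewrite -mulrA; apply: hP => i.
  by rewrite -scalemxAr mxE normrM gtr0_norm// ler_pM2l.
have krE : kap * x * (x^-1 * r) = kap * r by rewrite mulrA mulfK.
have cE : cube_points (map_mx intr D) (x^-1 *: t) (x^-1 * r) = cube_points P t r.
  by rewrite BE cube_pointsZ ?invr_gt0.
have [] := @ncard_integral_lattice R N D (x^-1 *: t) (kap * x) (x^-1 * r) hB.
- by rewrite krE.
- by rewrite mulrCA -(@ler_pM2l _ x)// mulr1 mulVKf.
rewrite krE cE -/n -/E.
have -> : `|\det P| = x ^+ N * `|\det (map_mx intr D)|.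
  by rewrite detZ normrM ger0_norm// exprn_ge0// ltW.
have -> : 2 * r + x = x * (2 * (x^-1 * r) + 1) by field.
have -> : 2 * r - x = x * (2 * (x^-1 * r) - 1) by field.
have xN : 0 < x ^+ N by rewrite exprn_gt0.
rewrite !exprMn => h1 h2; split.
  by rewrite mulrCA [E * _]mulrCA -mulrDr ler_pM2l.
by rewrite [leRHS]mulrCA ler_pM2l.
Qed.

Lemma mulmx_perturb (R : realType) (N : nat) (A P : 'M[R]_N) (x s : R)
    (c : 'rV[R]_N) : 0 <= s ->
  (forall i j, `|P i j - A i j| <= x) -> (forall j, `|c 0 j| <= s) ->
  forall i, `|(c *m P) 0 i - (c *m A) 0 i| <= N%:R * x * s.
Proof.
move=> s0 PA cs i; rewrite !mxE -sumrB; apply: le_trans (ler_norm_sum _ _ _) _.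
apply: (@le_trans _ _ (\sum_(j < N) x * s)).
  apply: ler_sum => j _; rewrite -mulrBr normrM mulrC.
  by apply: ler_pM.
by rewrite sumr_const card_ord -mulrA mulr_natl.
Qed.

(** For the largest coordinate [s] in absolute value, passing from [P] to [A] gives
    [s <= kap * (rho + N * x * s)], which is solved for [s]. *)
Lemma coords_le_perturb (R : realType) (N : nat) (A P : 'M[R]_N) (kap x : R) :
  0 <= kap -> 0 <= x -> kap * (N%:R * x) < 1 ->
  (forall i j, `|P i j - A i j| <= x) -> coords_le A kap ->
  coords_le P (kap / (1 - kap * (N%:R * x))).
Proof.
move=> kap0 x0 kx1 PA hA c rho cP j.
have [j0 _ jmax] := @arg_maxP _ _ _ j predT (fun i => `|c 0 i|) isT.
apply: le_trans (jmax j isT) _; set s := `|c 0 j0|.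
have : s <= kap * (rho + N%:R * x * s).
  apply: hA => i; have := mulmx_perturb (normr_ge0 (c 0 j0)) PA (fun j => jmax j isT) i.
  have := cP i; rewrite -/s => h1; rewrite distrC => h2.
  rewrite -[X in `|X|](subrK ((c *m P) 0 i)) addrC.
  exact: le_trans (ler_normD _ _) (lerD h1 h2).
by move=> h; rewrite mulrAC ler_pdivlMr ?subr_gt0//; lra.
Qed.

Lemma cvg_det (R : realType) (N : nat) (P : nat -> 'M[R]_N) (A : 'M[R]_N) :
  (forall i j, P n i j @[n --> \oo] --> A i j) ->
  \det (P n) @[n --> \oo] --> \det A.
Proof.
move=> PA; rewrite /determinant.
apply: (@cvg_big R _ +%R 0 _ (@add_continuous R^o)) => s _.
apply: cvgM; first exact: cvg_cst.
by apply: (@cvg_big R _ *%R 1 _ (@mul_continuous R)) => i _; exact: PA.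
Qed.

Lemma cvg_expr (R : realType) (k : nat) (u : nat -> R) (l : R) :
  u n @[n --> \oo] --> l -> u n ^+ k @[n --> \oo] --> l ^+ k.
Proof.
move=> ul; apply: (@continuous_cvg _ _ _ _ _ u (fun x => x ^+ k)) => //.
exact: exprn_continuous.
Qed.

(** The basis is rounded to rational matrices [P k]. The cube of radius [r] for [A] is compared with
    cubes of radii [r + w k] and [r - w k] for [P k], where [w k] tends to zero. The count [n] for
    [A] stays fixed in the limit, so no continuity of the count is needed. *)
Lemma ncard_lattice_cube (R : realType) (N : nat) (A : 'M[R]_N) (t : 'rV[R]_N)
    (kap r : R) : coords_le A kap -> 0 <= kap -> 0 < r ->
  `|(ncard (cube_points A t r))%:R - (2 * r) ^+ N / `|\det A| |
  <= N%:R * (2 * (kap * r) + 1) ^+ N.-1.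
Proof.
move=> hA kap0 r0; set n := (ncard _)%:R; set E := N%:R * _.
have Au := coords_le_unit hA.
have dA0 : 0 < `|\det A| by rewrite normr_gt0 -unitfE -unitmxE.
pose x (k : nat) : R := k.+1%:R^-1.
have x0 k : 0 < x k by rewrite invr_gt0.
have xcvg : x k @[k --> \oo] --> 0 by exact: cvg_harmonic.
pose P k : 'M[R]_N :=
  x k *: map_mx intr (map_mx Num.floor (k.+1%:R *: A)).
have PA k i j : `|P k i j - A i j| <= x k.
  rewrite !mxE; set a := _ * A i j; have -> : A i j = x k * a by rewrite /a mulKf.
  rewrite -mulrBr normrM gtr0_norm// ler_piMr// 1?ltW//.
  have := floor_le a; have := floorD1_gt a; rewrite intrD ltr_norml => ? ?.
  by apply/andP; split; lra.
have Pcvg : \det (P k) @[k --> \oo] --> \det A.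
  apply: cvg_det => i j; apply/cvgrPdist_le => e e0.
  have xe : \forall k \near \oo, x k < e by apply: cvgr_lt e0.
  apply: filterS xe => k xe.
  by rewrite distrC (le_trans (PA k i j))// ltW.
have dPcvg : `|\det (P k)| @[k --> \oo] --> `|\det A| by exact: cvg_norm.
pose kp k := kap / (1 - kap * (N%:R * x k)).
pose T := \sum_i `|t 0 i|; have Tt i : `|t 0 i| <= T.
  by rewrite /T (bigD1 i)//= lerDl sumr_ge0.
have T0 : 0 <= T by rewrite sumr_ge0.
(* Bounds all integer coordinates of points in a cube of radius at most [r] about [t], for every
   basis with constant [2 * kap]. Hence replacing [A] by [P k] moves each such point by at most
   [w k]. *)
pose Z := 2 * kap * (T + r).
have Z0 : 0 <= Z by rewrite !mulr_ge0// addr_ge0// ltW.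
pose w k := N%:R * x k * Z.
have w0 k : 0 <= w k.
  by apply: mulr_ge0 => //; apply: mulr_ge0; [exact: ler0n|exact: ltW].
have kpcvg : kp k @[k --> \oo] --> kap.
  have -> : kap = kap / (1 - kap * (N%:R * 0)) by rewrite !mulr0 subr0 divr1.
  apply: cvgMl_tmp; apply: cvgV; first by rewrite !mulr0 subr0 oner_neq0.
  apply: cvgB; first exact: cvg_cst.
  by do 2 apply: cvgMl_tmp.
have wcvg : w k @[k --> \oo] --> 0.
  rewrite -(mul0r Z) -(mulr0 N%:R); apply: cvgMr_tmp; exact: cvgMl_tmp.
have small : \forall k \near \oo, kap * (N%:R * x k) < 1 / 2.
  have sc : kap * (N%:R * x k) @[k --> \oo] --> 0.
    by rewrite -(mulr0 kap) -(mulr0 N%:R); do 2 apply: cvgMl_tmp.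
  have half0 : 0 < 1 / 2 :> R by rewrite divr_gt0.
  exact: cvgr_lt sc _ half0.
(* Ensures that the smaller radius [r - w k] is nonnegative and that the mesh [x k] is at most twice
   it. *)
have small2 : \forall k \near \oo, w k + x k < r.
  have sc : w k + x k @[k --> \oo] --> 0.
    by rewrite -[X in _ --> X](addr0 0); exact: cvgD.
  exact: cvgr_lt sc _ r0.
have kp_bound k : kap * (N%:R * x k) < 1 / 2 ->
    coords_le (P k) (kp k) /\ 0 <= kp k <= 2 * kap.
  move=> h; split.
    apply: coords_le_perturb => //; [exact: ltW|lra].
  have h0 : 0 < 1 - kap * (N%:R * x k) by lra.
  apply/andP; split; first by apply: divr_ge0 => //; exact: ltW.
  rewrite ler_pdivrMr//.
  have : kap * (kap * (N%:R * x k)) <= kap * (1 / 2) by rewrite ler_wpM2l// ltW.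
  by lra.
have into (B : 'M[R]_N) rho z : coords_le B (2 * kap) -> rho <= r ->
    cube_points B t rho z -> forall j, `|(map_mx intr z) 0 j| <= Z.
  move=> hB rr zS j; apply: hB => i; have := zS i; have := Tt i.
  rewrite [X in _ -> `|X| <= _ -> _]mxE [(- t) 0 i]mxE => h1 h2.
  rewrite -[X in `|X|](subrK (t 0 i)); apply: le_trans (ler_normD _ _) _.
  by lra.
have pert (B C : 'M[R]_N) rho y z : coords_le B (2 * kap) -> rho <= r ->
    (forall i j, `|C i j - B i j| <= y) -> 0 <= y ->
    cube_points B t rho z -> cube_points C t (rho + N%:R * y * Z) z.
  move=> hB rr CB y0 zS i; have := mulmx_perturb Z0 CB (into _ _ _ hB rr zS) i.
  have := zS i; rewrite ![(_ - t) 0 i]mxE; set b := (_ *m B) 0 i.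
  set c := (_ *m C) 0 i; set ti := (- t) 0 i => h1 h2.
  have -> : c + ti = (b + ti) + (c - b) by ring.
  exact: le_trans (ler_normD _ _) (lerD h1 h2).
have monoK (B : 'M[R]_N) k1 k2 : k1 <= k2 -> coords_le B k1 -> coords_le B k2.
  move=> k12 hB c rho cB j; apply: le_trans (hB c rho cB j) _.
  by apply: ler_wpM2r => //; apply: le_trans (cB j).
have up : n * `|\det A| <= (2 * r) ^+ N + E * `|\det A|.
  pose f k := (2 * (r + w k) + x k) ^+ N
    + N%:R * (2 * (kp k * (r + w k)) + 1) ^+ N.-1 * `|\det (P k)|.
  have fcvg : f k @[k --> \oo] --> (2 * r) ^+ N + E * `|\det A|.
    have rw : r + w k @[k --> \oo] --> r.
      by rewrite -[X in _ --> X]addr0; apply: cvgD => //; exact: cvg_cst.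
    apply: cvgD.
      apply: cvg_expr; rewrite -[X in _ --> X]addr0; apply: cvgD => //.
      exact: cvgMl_tmp.
    apply: cvgM => //; apply: cvgMl_tmp; apply: cvg_expr.
    apply: cvgD; last exact: cvg_cst.
    by apply: cvgMl_tmp; apply: cvgM.
  have gcvg : n * `|\det (P k)| @[k --> \oo] --> n * `|\det A| by exact: cvgMl_tmp.
  apply: (ler_cvg_to gcvg fcvg); near=> k.
  have [hP /andP[kp0 kp2]] : coords_le (P k) (kp k) /\ 0 <= kp k <= 2 * kap.
    by apply: kp_bound; near: k.
  have rw0 : 0 < r + w k by rewrite ltr_wpDr.
  have [||+ _] := @ncard_rational_lattice R N _ t (kp k) (r + w k) (x k) (x0 k) hP.
  - by rewrite mulr_ge0// ltW.
  - have : w k + x k < r by near: k.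
    by have := w0 k; have := x0 k; lra.
  rewrite -/(P k); apply: le_trans; apply: ler_wpM2r => //.
  rewrite ler_nat; apply: ncardS.
    by apply: cube_points_finite hP _; rewrite mulr_ge0// ltW.
  move=> z; apply: pert => //; last exact: ltW.
    by apply: monoK hA; lra.
have lo : (2 * r) ^+ N <= (n + E) * `|\det A|.
  pose f k := (n + N%:R * (2 * (kp k * (r - w k)) + 1) ^+ N.-1) * `|\det (P k)|.
  have rw : r - w k @[k --> \oo] --> r.
    by rewrite -[X in _ --> X]subr0; apply: cvgB => //; exact: cvg_cst.
  have fcvg : f k @[k --> \oo] --> (n + E) * `|\det A|.
    apply: cvgM => //; apply: cvgD; first exact: cvg_cst.
    apply: cvgMl_tmp; apply: cvg_expr.
    apply: cvgD; last exact: cvg_cst.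
    by apply: cvgMl_tmp; apply: cvgM.
  have gcvg : (2 * (r - w k) - x k) ^+ N @[k --> \oo] --> (2 * r) ^+ N.
    apply: cvg_expr; rewrite -[X in _ --> X]subr0; apply: cvgB => //.
    exact: cvgMl_tmp.
  apply: (ler_cvg_to gcvg fcvg); near=> k.
  have [hP /andP[kp0 kp2]] : coords_le (P k) (kp k) /\ 0 <= kp k <= 2 * kap.
    by apply: kp_bound; near: k.
  have wxr : w k + x k < r by near: k.
  have rw0 : 0 <= r - w k by have := x0 k; lra.
  have [||_] := @ncard_rational_lattice R N _ t (kp k) (r - w k) (x k) (x0 k) hP.
  - by rewrite mulr_ge0.
  - by have := x0 k; have := w0 k; nra.
  rewrite -/(P k) => /le_trans; apply; apply: ler_wpM2r => //.
  rewrite lerD2r ler_nat; apply: ncardS.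
    by apply: cube_points_finite hA _; rewrite mulr_ge0// ltW.
  move=> z zS; rewrite (_ : r = r - w k + N%:R * x k * Z); last by rewrite subrK.
  apply: pert zS; [exact: monoK hP|by rewrite gerBl|by move=> i j; rewrite distrC|exact: ltW].
have V1 : (2 * r) ^+ N / `|\det A| <= n + E by rewrite ler_pdivrMr.
have V2 : n - E <= (2 * r) ^+ N / `|\det A|.
  by rewrite ler_pdivlMr// mulrBl lerBlDr.
by rewrite ler_norml; apply/andP; split; lra.
Unshelve. all: by end_near.
Qed.

(** * Boxes and weakly admissible lattices *)

Lemma powR_invn_expr (R : realType) (N : nat) (a : R) : (0 < N)%N -> 0 <= a ->
  (a `^ N%:R^-1) ^+ N = a.
Proof.
move=> N0 a0; rewrite -powR_mulrn ?powR_ge0// -powRrM mulVf ?powRr1//.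
by rewrite pnatr_eq0 -lt0n.
Qed.

(** The largest coordinate is at least the geometric mean of all of them in absolute value, and the
    Euclidean norm is at least the largest coordinate. *)
Lemma le_dotrv_prod (R : realType) (N : nat) (y : 'rV[R]_N) (a : R) :
  (0 < N)%N -> 0 <= a -> a ^+ N <= `|\prod_i y 0 i| -> a ^+ 2 <= dotrv y y.
Proof.
move=> N0 a0 ay; pose i0 : 'I_N := Ordinal N0.
have [j _ jmax] := @arg_maxP _ _ _ i0 predT (fun i => `|y 0 i|) isT.
have : a <= `|y 0 j|.
  rewrite -(@ler_pXn2r _ N)// ?nnegrE//; apply: le_trans ay _.
  rewrite normr_prod -[X in _ ^+ X]card_ord -prodr_const.
  by apply: ler_prod => i _; apply/andP; split; [exact: normr_ge0|exact: jmax].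
rewrite -(@ler_pXn2r _ 2)// ?nnegrE// real_normK ?num_real// => /le_trans; apply.
rewrite /dotrv (bigD1 j)//= -expr2 lerDl.
by apply: sumr_ge0 => i _; rewrite -expr2 sqr_ge0.
Qed.

(* The hypothesis on [B] is what [reduced_basis] provides: the constant [C] has to
   be chosen before the lattice. *)
Lemma lattice_box_count (R : realType) (N : nat) (C : R) (A : 'M[R]_N)
    (Q : 'I_N -> R) (t : 'rV[R]_N) (g lam : R) :
  (forall B : 'M[R]_N,
    (forall z : 'rV[int]_N, z != 0 ->
      lam ^+ 2 <= dotrv (map_mx intr z *m B) (map_mx intr z *m B)) ->
    exists2 U : 'M[int]_N, U \in unitmx & forall (c : 'rV[R]_N) j,
      lam ^+ 2 * c 0 j ^+ 2
      <= C * dotrv (c *m (map_mx intr U *m B)) (c *m (map_mx intr U *m B))) ->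
  0 <= C -> (forall i, 0 < Q i) -> 0 < g -> g ^+ N = \prod_i Q i -> 0 < lam ->
  (forall z : 'rV[int]_N, z != 0 -> lam ^+ 2 <=
    dotrv (map_mx intr z *m (A *m diag_mx (\row_i (g / Q i))))
          (map_mx intr z *m (A *m diag_mx (\row_i (g / Q i))))) ->
  let S := [set map_mx intr z *m A | z in [set: 'rV[int]_N]]
    `&` translate t (centered_box Q) in
  finite_set S /\
  `|(ncard S)%:R - (\prod_i (2 * Q i)) / `|\det A| |
  <= N%:R * (2 * (Num.sqrt (C * N%:R) * (g / lam)) + 1) ^+ N.-1.
Proof.
move=> red C0 Q0 g0 gN lam0; set D := diag_mx _ => Alam S.
have [U Uu hU] := red _ Alam.
set K := Num.sqrt _.
have K0 : 0 <= K by exact: sqrtr_ge0.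
pose B := map_mx intr U *m (A *m D).
(* The reduced basis bounds coordinates by the Euclidean norm; passing to the sup norm costs the
   factor [N] under the root in [K]. *)
have hB : coords_le B (K / lam).
  move=> c rho cB j; have rho0 : 0 <= rho by apply: le_trans (cB j).
  have dB : dotrv (c *m B) (c *m B) <= N%:R * rho ^+ 2.
    rewrite mulr_natl -[X in _ *+ X]card_ord -sumr_const.
    apply: ler_sum => i _; rewrite -expr2 -real_normK ?num_real//.
    by rewrite ler_pXn2r ?nnegrE.
  rewrite mulrAC ler_pdivlMr// -(@ler_pXn2r _ 2)// ?nnegrE ?mulr_ge0// ?(ltW lam0)//.
  rewrite !exprMn real_normK ?num_real// [leLHS]mulrC (le_trans (hU c j))//.
  by rewrite /K sqr_sqrtr ?mulr_ge0// -mulrA ler_wpM2l.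
have BE z i : (map_mx intr z *m B - t *m D) 0 i
    = (map_mx intr (z *m U) *m A - t) 0 i * (g / Q i).
  rewrite /B map_mxM !mulmxA -mulmxBl mul_mx_diag.
  by rewrite [in LHS]mxE [in X in _ * X = _]mxE.
have BS z : cube_points B (t *m D) g z <->
    translate t (centered_box Q) (map_mx intr (z *m U) *m A).
  have gQ i (x : R) : (`|x * (g / Q i)| <= g) = (- Q i <= x <= Q i).
    rewrite normrM (gtr0_norm (divr_gt0 g0 (Q0 i))) mulrCA ger_pMr//.
    by rewrite ler_pdivrMr// mul1r ler_norml.
  split=> [zS|[y yQ yE] i].
    exists (map_mx intr (z *m U) *m A - t); last by rewrite addrC subrK.
    by move=> i; rewrite -gQ -BE.
  by rewrite BE -yE addrC addKr gQ.
have SE : S = [set map_mx intr (z *m U) *m A | z in cube_points B (t *m D) g].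
  apply/seteqP; split=> [_ [[z _ <-] zZ]|_ [z zS <-]].
    exists (z *m invmx U); last by rewrite mulmxKV.
    by apply/BS; rewrite mulmxKV.
  by split; [exists (z *m U)|apply/BS].
have Bu := coords_le_unit hB.
have Au : A \in unitmx by move: Bu; rewrite /B !unitmx_mul => /andP[_ /andP[]].
have fI : {in cube_points B (t *m D) g &,
    injective (fun z : 'rV[int]_N => map_mx intr (z *m U) *m A)}.
  move=> z w _ _ /(can_inj (mulmxK Au)) zw; apply: (can_inj (mulmxK Uu)).
  by apply/rowP => i; have := congr1 (fun x : 'rV[R]_N => x 0 i) zw;
    rewrite ![map_mx _ _ 0 i]mxE => /intr_inj.
have Bfin : finite_set (cube_points B (t *m D) g).
  by apply: cube_points_finite hB _; rewrite !mulr_ge0 ?invr_ge0// ltW.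
have Sfin : finite_set S by rewrite SE; exact: finite_image.
split=> //.
have -> : ncard S = ncard (cube_points B (t *m D) g).
  rewrite SE; apply: card_fset_set; apply: card_eq_trans (inj_card_eq fI) _.
  exact: card_eq_ncard.
have prodQ0 : 0 < \prod_i Q i by apply: prodr_gt0.
have detB : `|\det B| = `|\det A|.
  rewrite /B !det_mulmx det_diag !normrM det_map_mx -intr_norm.
  have -> : \prod_i (\row_i (g / Q i)) 0 i = 1 :> R.
    under eq_bigr do rewrite mxE.
    by rewrite big_split /= prodfV prodr_const card_ord gN divff// gt_eqF.
  rewrite normr1 mulr1; move: Uu; rewrite unitmxE => uU.
  by case/orP: (uU : (\det U == 1) || (\det U == -1)) => /eqP ->;
    rewrite ?normrN1 ?normr1 mul1r.
have -> : \prod_i (2 * Q i) = (2 * g) ^+ N.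
  by rewrite big_split /= prodr_const card_ord exprMn gN.
rewrite -detB; have -> : K * (g / lam) = K / lam * g by rewrite mulrA mulrAC.
by apply: ncard_lattice_cube => //; apply: divr_ge0 => //; exact: ltW.
Qed.

(** If [x] is shorter than [B], then [nu] bounds the product of its coordinates, which the dilation
    preserves. Otherwise every dilation factor is at least [g / q], so the image has length at least
    [g * B / q >= lam]. *)
Lemma dilated_lattice_min (R : realType) (N : nat) (L : set 'rV[R]_N)
    (Q : 'I_N -> R) (g q B lam : R) (x : 'rV[R]_N) : (0 < N)%N ->
  (forall i, 0 < Q i <= q) -> 0 < g -> g ^+ N = \prod_i Q i -> 0 <= lam ->
  0 <= B -> (lam%:E <= nu L B)%E -> lam * q <= g * B -> L x -> x != 0 ->
  lam ^+ 2 <= dotrv (x *m diag_mx (\row_i (g / Q i)))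
                    (x *m diag_mx (\row_i (g / Q i))).
Proof.
move=> N0 Qq g0 gN lam0 B0 lam_nu lamB Lx x0.
set y := x *m _.
have Q0 i : 0 < Q i by have /andP[] := Qq i.
have yE i : y 0 i = x 0 i * (g / Q i) by rewrite /y mul_mx_diag !mxE.
have [xB|xB] := ltP (enorm x) B.
  have : lam <= `|\prod_i x 0 i| `^ N%:R^-1.
    rewrite -lee_fin; apply: le_trans lam_nu _; apply: ereal_inf_lbound.
    by exists x.
  rewrite -(@ler_pXn2r _ N)// ?nnegrE ?powR_ge0// powR_invn_expr// => h.
  apply: le_dotrv_prod => //; apply: le_trans h _.
  under [in leRHS]eq_bigr do rewrite yE.
  rewrite big_split /= big_split /= prodfV prodr_const card_ord gN divff ?mulr1//.
  by rewrite gt_eqF// prodr_gt0.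
have q0 : 0 < q by have /andP[] := Qq (Ordinal N0); exact: lt_le_trans.
apply: (@le_trans _ _ ((g * B / q) ^+ 2)).
  by rewrite ler_pXn2r ?nnegrE// ?divr_ge0 ?mulr_ge0 ?(ltW g0) ?(ltW q0)// ler_pdivlMr.
have : B ^+ 2 <= \sum_i x 0 i ^+ 2.
  move: xB; rewrite -(@ler_pXn2r _ 2)// ?nnegrE ?sqrtr_ge0// sqr_sqrtr//.
  by apply: sumr_ge0 => i _; exact: sqr_ge0.
rewrite mulrAC exprMn => h.
apply: (@le_trans _ _ ((g / q) ^+ 2 * \sum_i x 0 i ^+ 2)).
  by rewrite ler_wpM2l ?sqr_ge0.
rewrite mulr_sumr; apply: ler_sum => i _; rewrite -expr2 yE [leRHS]exprMn [leRHS]mulrC.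
rewrite ler_wpM2r ?sqr_ge0// ler_pXn2r ?nnegrE ?divr_ge0 ?(ltW g0) ?(ltW q0) ?(ltW (Q0 i))//.
rewrite ler_pM2l// lef_pV2 ?posrE//.
by have /andP[] := Qq i.
Qed.

Theorem theorem1p1 (R : realType) (N : nat) (hN : (2 <= N)%N) :
  exists C : R, 0 < C /\
    forall (L : set 'rV[R]_N) (Q : 'I_N -> R) (t : 'rV[R]_N),
      weakly_admissible L ->
      (forall i, 0 < Q i) ->
      let Z := translate t (centered_box Q) in
      (`| counting (L `&` Z) - vol Z / (lattice_det L)%:E |
       <= C%:E * ereal_inf
            [set ((geo_mean Q)%:E / nu L B + (Qmax Q / B)%:E) ^+ N.-1
            | B in [set B : R | (0 < B)%R /\ (B <= Qmax Q)%R]])%E.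
Proof.
have N0 : (0 < N)%N by apply: ltnW.
have N1 : (0 < N.-1)%N by rewrite ltn_predRL.
have [C C0 red] := reduced_basis R N.
set K := Num.sqrt (C * N%:R); have K0 : 0 <= K by exact: sqrtr_ge0.
(* With [lam = g / X] the cube bound is [N * (2 * K * X + 1) ^+ N.-1], and [X >= 1] allows the
   summand 1 to be absorbed into [X]. *)
pose C1 := N%:R * (2 * K + 1) ^+ N.-1.
have C1_gt0 : 0 < C1 by rewrite mulr_gt0 ?ltr0n// exprn_gt0// ltr_wpDl// mulr_ge0.
exists C1; split=> // L Q t [[A LA] nu0] Q0; cbv zeta.
set Z := translate _ _.
pose g := geo_mean Q.
have prodQ0 : 0 < \prod_i Q i by apply: prodr_gt0.
have g0 : 0 < g by exact: powR_gt0.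
have gN : g ^+ N = \prod_i Q i by apply: powR_invn_expr => //; exact: ltW.
have Qmax_ge i : 0 < Q i <= Qmax Q by rewrite Q0 /Qmax le_bigmax.
have LE : L = [set map_mx intr z *m A | z in [set: 'rV[int]_N]] by case: LA.
have dA0 : 0 < `|\det A|.
  by case: LA => Au _; rewrite normr_gt0 -unitfE -unitmxE.
set S := L `&` Z; set v := (\prod_i (2 * Q i)) / `|\det A|.
have bound B : 0 < B -> B <= Qmax Q -> exists X : R,
    [/\ (g%:E / nu L B + (Qmax Q / B)%:E)%E = X%:E, finite_set S
      & `|(ncard S)%:R - v| <= C1 * X ^+ N.-1].
  move=> B0 Bq; have nuB := nu0 B B0.
  have q0 : 0 < Qmax Q by exact: lt_le_trans Bq.
  have qB : 1 <= Qmax Q / B by rewrite ler_pdivlMr// mul1r.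
  (* The bracket is a real number because [nu L B] is positive; if it is [+oo], the first summand is
     zero and any [lam] lies below [nu L B]. *)
  have [X [XE qX gX]] : exists X : R,
      [/\ (g%:E / nu L B + (Qmax Q / B)%:E)%E = X%:E, Qmax Q / B <= X
        & forall lam : R, 0 < lam -> lam <= g / X -> (lam%:E <= nu L B)%E].
    case: (nu L B) nuB => [a| |]//.
    - rewrite lte_fin => a0; exists (g / a + Qmax Q / B); split.
      + by rewrite inver gt_eqF.
      + by rewrite lerDr divr_ge0// ltW.
      move=> lam lam0; rewrite lee_fin ler_pdivlMr; last first.
        by rewrite addr_gt0 ?divr_gt0.
      move=> h; have : lam * (g / a) <= g.
        by apply: le_trans h; rewrite ler_pM2l// lerDl divr_ge0 ?ltW.
      by rewrite mulrCA ger_pMr// ler_pdivrMr// mul1r.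
    - move=> _; exists (Qmax Q / B); split=> //; first by rewrite invey mule0 add0e.
      by move=> lam _ _; rewrite leey.
  have X1 : 1 <= X by exact: le_trans qX.
  have X0 : 0 < X by exact: lt_le_trans X1.
  have lam0 : 0 < g / X by rewrite divr_gt0.
  have Alam z : z != 0 -> (g / X) ^+ 2 <=
      dotrv (map_mx intr z *m (A *m diag_mx (\row_i (g / Q i))))
            (map_mx intr z *m (A *m diag_mx (\row_i (g / Q i)))).
    move=> z0; rewrite !mulmxA.
    apply: (@dilated_lattice_min _ _ L Q g (Qmax Q) B) => //; try exact: ltW.
    - exact: gX.
    - rewrite mulrAC ler_pdivrMr// -mulrA ler_pM2l// mulrC.
      by rewrite -ler_pdivrMr.
    - by rewrite LE; exists z.
    apply: contraNneq z0 => /(congr1 (mulmx^~ (invmx A))).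
    rewrite mulmxK ?mul0mx; last by case: LA.
    move=> /rowP z0; apply/eqP/rowP => i; have /eqP := z0 i.
    by rewrite !mxE intr_eq0 => /eqP.
  have [Sfin Sle] := @lattice_box_count R N C A Q t g (g / X)
    (fun B' => red N B' (g / X) lam0) C0 Q0 g0 gN lam0 Alam.
  rewrite -LE -/S in Sfin Sle.
  exists X; split=> //; apply: le_trans Sle _.
  have gXE : g / (g / X) = X by rewrite invf_div mulrCA divff ?mulr1// gt_eqF.
  rewrite -/K gXE /C1 -mulrA ler_wpM2l//.
  have KX0 : 0 <= K * X by rewrite mulr_ge0// ltW.
  rewrite -exprMn ler_pXn2r ?nnegrE//; last by rewrite mulr_ge0 ?(ltW X0)//; lra.
    by lra.
  by lra.
have q0 : 0 < Qmax Q.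
  by have /andP[] := Qmax_ge (Ordinal N0); exact: lt_le_trans.
(* The admissible value [B = Qmax Q] is used only to know that [S] is finite, so that [counting]
   equals [ncard]. *)
have [X0 [_ Sfin _]] := bound _ q0 (lexx _).
have -> : vol Z = (\prod_i (2 * Q i))%:E by exact: vol_translate_box.
rewrite (lattice_detE LA) inver gt_eqF// -EFinM -/v.
have -> : counting S = (ncard S)%:R%:E :> \bar R.
  by rewrite /counting asboolT.
rewrite -EFinB abse_EFin; set e := `|_|.
(* With [C1] factored out, it remains to see that [e / C1] is a lower bound of the set under the
   infimum. *)
have -> : e%:E = (C1%:E * (e / C1)%:E)%E.
  by rewrite -EFinM mulrCA divff ?mulr1// gt_eqF.
apply: lee_wpmul2l; first by rewrite lee_fin ltW.
apply: le_ereal_inf_tmp => _ [B [B0 Bq] <-].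
have [X [-> _ h]] := bound B B0 Bq.
by rewrite -EFin_expe lee_fin ler_pdivrMr// mulrC.
Qed.
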